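(* Let $G$ be a non-Abelian group and let $I$ be an uncountable set. Then the direct sum $\bigoplus_{\alpha \in I} G$ of isomorphic copies of $G$ indexed by $I$ does not embed in $\mathrm{Homeo}_{+}(\mathbb{R})$; that is, there is no injective group homomorphism $\bigoplus_{\alpha \in I} G \to \mathrm{Homeo}_{+}(\mathbb{R})$.
   Context: $\mathrm{Homeo}_{+}(\mathbb{R})$ denotes the group of all orientation-preserving (i.e. strictly increasing) homeomorphisms of the real line $\mathbb{R}$ under composition. The direct sum $\bigoplus_{\alpha\in I} G$ is the subgroup of the direct product $\prod_{\alpha \in I} G$ consisting of the families $(g_\alpha)_{\alpha\in I}$ with $g_\alpha = 1$ for all but finitely many $\alpha$. ''Embeds'' means embeds as an abstract group (no continuity is required). *)

(* Defs.v *)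
From HB Require Import structures.
From mathcomp Require Import all_boot all_order all_algebra.
From mathcomp Require Import all_classical all_reals all_analysis.

Set Implicit Arguments.
Unset Strict Implicit.
Unset Printing Implicit Defensive.

Import Order.TTheory GRing.Theory Num.Theory.
Import numFieldNormedType.Exports.

Local Open Scope classical_set_scope.
Local Open Scope group_scope.

(* A named copy of I -> G, so that the pointwise group structure declared below
   does not attach to arbitrary function types. *)
Definition direct_product (I : Type) (G : groupType) : Type := I -> G.

Section DirectProduct.
Variables (I : Type) (G : groupType).
Local Notation P := (direct_product I G).

HB.instance Definition _ := Choice.on P.

Let one : P := fun=> 1.
Let inv (g : P) : P := fun i => (g i)^-1.
Let mul (g h : P) : P := fun i => g i * h i.

Let mulA : associative mul.
Proof. by move=> f g h; apply/funext => i; exact: mulgA. Qed.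
Let mul1 : left_id one mul.
Proof. by move=> f; apply/funext => i; exact: mul1g. Qed.
Let mulg1 : right_id one mul.
Proof. by move=> f; apply/funext => i; exact: mulg1. Qed.
Let mulV : left_inverse one inv mul.
Proof. by move=> f; apply/funext => i; exact: mulVg. Qed.
Let mulgV : right_inverse one inv mul.
Proof. by move=> f; apply/funext => i; exact: mulgV. Qed.

HB.instance Definition _ := isGroup.Build P mulA mul1 mulg1 mulV mulgV.

Lemma direct_product1E i : (1 : P) i = 1. Proof. by []. Qed.
Lemma direct_productME (g h : P) i : (g * h) i = g i * h i.
Proof. by []. Qed.
Lemma direct_productVE (g : P) i : g^-1 i = (g i)^-1. Proof. by []. Qed.

End DirectProduct.

Definition finsupp_pred (I : Type) (G : groupType) :
    {pred direct_product I G} :=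
  fun g => `[< finite_set [set i | g i <> 1] >].

Section DirectSum.
Variables (I : Type) (G : groupType).

Fact finsupp_pred_closed : group_closed (finsupp_pred (I := I) (G := G)).
Proof.
split=> [|g h].
  apply/asboolP; rewrite (_ : [set _ | _] = set0) //.
  by apply/seteqP; split=> i.
move=> /asboolP fg /asboolP fh; apply/asboolP.
apply: (@sub_finite_set _ _ ([set i | g i <> 1] `|` [set i | h i <> 1])).
  move=> i /= ghi; case: (pselect (g i = 1)) => gi; last by left.
  right=> hi; apply: ghi.
  by rewrite direct_productME direct_productVE gi hi mulgV.
by rewrite finite_setU.
Qed.

Definition direct_sum : Type :=
  {g : direct_product I G | finsupp_pred g}.

HB.instance Definition _ := SubType.on direct_sum.
HB.instance Definition _ := [Choice of direct_sum by <:].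
HB.instance Definition _ :=
  SubChoice_isSubGroup.Build _ _ direct_sum finsupp_pred_closed.

Lemma direct_sumME (g h : direct_sum) i : val (g * h) i = val g i * val h i.
Proof. by []. Qed.

Lemma direct_sum_finite (g : direct_sum) : finite_set [set i | val g i <> 1].
Proof. by apply/asboolP; exact: (valP g). Qed.

End DirectSum.

(* The inverse map is carried as data; homeo_plus_eq shows that an element is
   determined by its underlying function, so this is the set of increasing
   homeomorphisms of the line. *)
Record homeo_plus (R : realType) := HomeoPlus {
  homeo_fun :> R -> R;
  homeo_inv : R -> R;
  homeo_funK : cancel homeo_fun homeo_inv;
  homeo_invK : cancel homeo_inv homeo_fun;
  homeo_fun_continuous : continuous homeo_fun;
  homeo_inv_continuous : continuous homeo_inv;
  homeo_fun_increasing : {homo homeo_fun : x y / (x < y)%R}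
}.

Section HomeoPlus.
Variable R : realType.
Local Notation H := (homeo_plus R).
Implicit Types f g h : H.

Lemma homeo_plus_eq f g : homeo_fun f =1 homeo_fun g -> f = g.
Proof.
case: f g => [f f' fK f'K fc f'c fi] [g g' gK g'K gc g'c gi] /= /funext fg.
subst g; have fg' : f' = g' by apply/funext => x; rewrite -{1}(g'K x) fK.
by subst g'; congr HomeoPlus; exact: Prop_irrelevance.
Qed.

Let id_continuous : continuous (@idfun R). Proof. by move=> x. Qed.

Definition homeo_one : H :=
  @HomeoPlus R idfun idfun (fun=> erefl) (fun=> erefl)
    id_continuous id_continuous (fun _ _ xy => xy).

Fact homeo_inv_increasing f : {homo homeo_inv f : x y / (x < y)%R}.
Proof.
move=> x y xy; rewrite ltNge; apply/negP; rewrite le_eqVlt => /orP[/eqP e|].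
  by move: xy; rewrite -(homeo_invK f x) -e homeo_invK ltxx.
by move=> /(@homeo_fun_increasing _ f); rewrite !homeo_invK ltNge ltW.
Qed.

Definition homeo_sym f : H :=
  HomeoPlus (@homeo_invK R f) (@homeo_funK R f)
    (@homeo_inv_continuous R f) (@homeo_fun_continuous R f)
    (@homeo_inv_increasing f).

Let comp_continuous (u v : R -> R) :
  continuous u -> continuous v -> continuous (u \o v).
Proof. by move=> uc vc x; apply: continuous_comp; [exact: vc|exact: uc]. Qed.

Definition homeo_mul f g : H :=
  HomeoPlus (can_comp (@homeo_funK R f) (@homeo_funK R g))
    (can_comp (@homeo_invK R g) (@homeo_invK R f))
    (comp_continuous (@homeo_fun_continuous R f) (@homeo_fun_continuous R g))
    (comp_continuous (@homeo_inv_continuous R g) (@homeo_inv_continuous R f))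
    (fun x y xy =>
       @homeo_fun_increasing R f _ _ (@homeo_fun_increasing R g x y xy)).

Let mulA : associative homeo_mul.
Proof. by move=> f g h; exact: homeo_plus_eq. Qed.
Let mul1 : left_id homeo_one homeo_mul.
Proof. by move=> f; exact: homeo_plus_eq. Qed.
Let mulg1 : right_id homeo_one homeo_mul.
Proof. by move=> f; exact: homeo_plus_eq. Qed.
Let mulV : left_inverse homeo_one homeo_sym homeo_mul.
Proof. by move=> f; apply: homeo_plus_eq => x; exact: homeo_funK. Qed.
Let mulgV : right_inverse homeo_one homeo_sym homeo_mul.
Proof. by move=> f; apply: homeo_plus_eq => x; exact: homeo_invK. Qed.

HB.instance Definition _ := gen_eqMixin H.
HB.instance Definition _ := gen_choiceMixin H.
HB.instance Definition _ := isGroup.Build H mulA mul1 mulg1 mulV mulgV.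

Lemma homeo_plus1E x : (1 : H) x = x. Proof. by []. Qed.
Lemma homeo_plusME f g x : (f * g) x = f (g x). Proof. by []. Qed.
Lemma homeo_plusVE f x : f^-1 x = homeo_inv f x. Proof. by []. Qed.

End HomeoPlus.

(* Main.v *)
Require Import Defs.
From mathcomp Require Import all_boot all_order all_algebra.
From mathcomp Require Import all_classical all_reals all_analysis.

Set Implicit Arguments.
Unset Strict Implicit.
Unset Printing Implicit Defensive.

Import Order.TTheory.

Local Open Scope classical_set_scope.
Local Open Scope group_scope.

(** Choose x, y in G that do not commute.  Embedding the direct sum gives, for
    each i in I, homeomorphisms a_i, b_i with nontrivial commutator c_i, and
    elements with different indices commute.  The contradiction compares the
    sizes of the c_i, in the spirit of translation numbers: a commutator of
    elements commuting with z cannot translate by more than about z.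

    Let q be a point with z q > q, and let a, b commute with z and send q
    between two points of the z-orbit of q.  Multiplying a and b by powers of z
    does not change [~ a, b], so q <= a q, b q < z q may be assumed, and then
    [~ a, b] q < z^2 q (comm_lt_hull).  If this applies to z = c_k and to
    c_i c_j = [~ a_i a_j, b_i b_j] for all distinct i, j, k, there is a
    contradiction: c_1 c_2 < c_0^2 and c_0 c_1 < c_2^2 at q multiply to
    c_1^2 < c_0 c_2 at q, while c_0 c_2 < c_1^2 (no_five_commuting_pairs).

    Two obstacles remain.  The points q must agree: c_i, up to exchanging a_i
    and b_i, moves some rational point to the right.  More seriously, a_i may
    carry q out of the convex hull of the c_k-orbit.  Uncountability removes
    both.  Record the rational q, and a rational point in the image of the
    interval from q to c_i q under each of c_i, a_i and b_i.  There are
    countably many possible markings, so infinitely many i share one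
    (pigeonhole_infinite).  Equal markings force the hulls of all c_i-orbits of q to coincide, and force a_i
    and a_g to move this hull in the same way, so that a_g^-1 a_i sends q into
    it (hull_quotient).  Replacing a_i by a_g^-1 a_i and b_i by b_d^-1 b_i, for
    two spare indices g and d, leaves the commutator c_i unchanged
    (comm_shift_invariant). *)

(** * Commutators of commuting pairs *)

Lemma commuteR (G : groupType) (z x y : G) :
  commute z x -> commute z y -> commute z [~ x, y].
Proof.
by move=> zx zy; do !apply: commuteM => //; exact: commuteV.
Qed.

Lemma commuteMl (G : groupType) (x y z : G) :
  commute x z -> commute y z -> commute (x * y) z.
Proof. by move=> xz yz; apply/commute_sym/commuteM; exact: commute_sym. Qed.

Lemma commuteVl (G : groupType) (x z : G) : commute x z -> commute x^-1 z.
Proof. by move=> xz; exact/commute_sym/commuteV/commute_sym. Qed.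

Lemma commgMM (G : groupType) (x x' y y' : G) :
  commute x x' -> commute x y' -> commute y x' -> commute y y' ->
  [~ x * x', y * y'] = [~ x, y] * [~ x', y'].
Proof.
move=> xx' xy' yx' yy'; apply: (@mulgI _ (y * y' * (x * x'))).
rewrite -commgC.
have -> : y * y' * (x * x') = y * x * (y' * x').
  by rewrite -!mulgA (mulgA y') -xy' !mulgA.
have cxy : commute (y' * x') [~ x, y].
  by apply: commuteR; apply: commute_sym; apply: commuteM.
rewrite [RHS]mulgA -[X in _ = X * _]mulgA cxy [X in _ = X * _]mulgA -commgC.
by rewrite -[RHS]mulgA -commgC -!mulgA (mulgA x' y) -yx' !mulgA.
Qed.

Lemma commgMl (G : groupType) (x y w : G) :
  commute w x -> commute w y -> [~ w * x, y] = [~ x, y].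
Proof.
move=> wx wy; have := @commgMM _ w x 1 y wx wy.
by rewrite mul1g commg1 mul1g; apply; exact/commute_sym/commute1.
Qed.

Lemma commgMr (G : groupType) (x y w : G) :
  commute w x -> commute w y -> [~ x, w * y] = [~ x, y].
Proof.
move=> wx wy.
have := @commgMM _ 1 x w y (commute_sym (commute1 x))
  (commute_sym (commute1 y)).
by rewrite mul1g (commgEr 1) conjg1 mulVg mul1g; exact.
Qed.

(** * Displacement of a commutator relative to a commuting element *)

Section Hull.
Variable R : realType.
Implicit Types (z f : homeo_plus R) (q : R).

Lemma homeo_leE f : {mono f : x y / (x <= y)%R}.
Proof. by apply: le_mono; exact: homeo_fun_increasing. Qed.

Lemma homeo_ltE f : {mono f : x y / (x < y)%R}.
Proof. exact: leW_mono (homeo_leE f). Qed.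

Lemma homeo_commuteE f (g : homeo_plus R) q : commute f g -> f (g q) = g (f q).
Proof. by move=> fg; rewrite -!homeo_plusME fg. Qed.

Lemma homeo_mulKV f q : f (f^-1 q) = q.
Proof. by rewrite -homeo_plusME mulgV. Qed.

(** When z q > q, this is the convex hull of the orbit of q under the powers
    of z, which is the component containing q of the set moved by z.  Both
    bounds use nonnegative powers only, so that they can be added. *)
Definition hull z q (x : R) :=
  exists n : nat, (q < (z ^+ n)%g x)%R /\ (x < (z ^+ n)%g q)%R.

(** As a commutes with z, it moves the bounds around b q to bounds around
    a (b q); the exponents add up. *)
Lemma hullM z (a b : homeo_plus R) q : commute z a ->
  hull z q (a q) -> hull z q (b q) -> hull z q ((a * b)%g q).
Proof.
move=> za [m [am ma]] [n [bn nb]]; exists (m + n); rewrite homeo_plusME.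
have zna : commute a (z ^+ n)%g by exact/commuteX/commute_sym.
split.
  apply: (lt_trans am); rewrite expgnDr homeo_plusME homeo_ltE.
  by rewrite -(homeo_commuteE _ zna) homeo_ltE.
move: nb; rewrite -(homeo_ltE a) => /lt_trans; apply.
by rewrite (homeo_commuteE _ zna) addnC expgnDr homeo_plusME homeo_ltE.
Qed.

(** An element keeping q in the hull can be brought, by a power w of z, to send
    q into the fundamental interval from q to z q.  What is kept
    of w is that it commutes with all that z commutes with, which is the
    condition for [~ w * a, b] = [~ a, b]. *)
Lemma hull_floor z (a : homeo_plus R) q : hull z q (a q) ->
  exists2 w, (forall x, commute z x -> commute w x) &
    (q <= (w * a)%g q < z q)%R.
Proof.
move=> [m [am ma]].
have ex : exists n : nat, ((z ^+ m)%g (a q) < (z ^+ n)%g q)%R.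
  by exists (m + m); rewrite expgnDr homeo_plusME homeo_ltE.
(* The least such n is positive, and its predecessor is the integer part
   of the displacement of z ^+ m * a measured in steps of z. *)
case: (ex_minnP ex) => -[|k] lt_k min_k.
  by move: (lt_trans am lt_k); rewrite homeo_plus1E ltxx.
exists ((z ^+ k)^-1 * z ^+ m).
  move=> x zx; apply: commute_sym.
  by apply: commuteM; [apply: commuteV|]; exact/commuteX/commute_sym.
rewrite !homeo_plusME -(homeo_leE (z ^+ k)) -(homeo_ltE (z ^+ k)) homeo_mulKV.
rewrite -(homeo_plusME _ z) -expgSr lt_k andbT leNgt.
by apply/negP => /min_k; rewrite ltnn.
Qed.

(** It suffices to bound a (b q) by b (a (z (z q))): the left side is below
    a (z q) = z (a q) < z (z q), and the right side is z (z (b (a q))), which is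
    at least z (z q) as neither a nor b moves q to the left. *)
Lemma comm_lt_sqr z (a b : homeo_plus R) q :
  commute z a -> commute z b -> (q <= a q < z q)%R -> (q <= b q < z q)%R ->
  ([~ a, b]%g q < z (z q))%R.
Proof.
move=> za zb /andP[a0 a1] /andP[b0 b1].
rewrite -(homeo_ltE (b * a)) -homeo_plusME -commgC !homeo_plusME.
apply: (@lt_le_trans _ _ (z (z q))).
  move: b1; rewrite -(homeo_ltE a) => /lt_trans; apply.
  by rewrite -(homeo_commuteE _ za) homeo_ltE.
rewrite -!(homeo_commuteE _ za) -!(homeo_commuteE _ zb) !homeo_leE.
by apply: (le_trans b0); rewrite homeo_leE.
Qed.

(** Multiplying a and b by powers of z changes neither their commutator nor
    the fact that they commute with z. *)
Lemma comm_lt_hull z (a b : homeo_plus R) q : commute z a -> commute z b ->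
  hull z q (a q) -> hull z q (b q) -> ([~ a, b]%g q < z (z q))%R.
Proof.
move=> za zb /hull_floor[v vC va] /hull_floor[w wC wb].
have zv : commute z v by exact/commute_sym/vC.
have zw : commute z w by exact/commute_sym/wC.
have <- : [~ v * a, w * b] = [~ a, b].
  rewrite commgMl; first by rewrite commgMr //; exact: wC.
    exact: vC.
  by apply: vC; apply: commuteM.
by apply: comm_lt_sqr => //; exact: commuteM.
Qed.

(** Overlapping images under a and a' of the intervals from q to c q and from
    q to c' q put a'^-1 (a q) within two steps of z from q. *)
Lemma hull_quotient z (a a' c c' : homeo_plus R) q :
  commute z a -> commute z a' ->
  (c q < z (z q))%R -> (c' q < z (z q))%R ->
  (a q < a' (c' q))%R -> (a' q < a (c q))%R ->
  hull z q ((a'^-1 * a)%g q).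
Proof.
move=> za za' cz c'z aa' a'a; exists 2; rewrite expg2 !homeo_plusME.
have za'V : commute z a'^-1 by exact: commuteV.
rewrite !(homeo_commuteE _ za'V) !(homeo_commuteE _ za).
rewrite -(homeo_ltE a') -(homeo_ltE a' (a'^-1 _)) !homeo_mulKV; split.
  by apply: (lt_trans a'a); rewrite homeo_ltE.
by apply: (lt_trans aa'); rewrite homeo_ltE.
Qed.

(** * Commuting pairs with a common marking *)

Section CommutingPairs.
Variables (a b : nat -> homeo_plus R) (q s t u : R).
Hypothesis aa : forall i j, i <> j -> commute (a i) (a j).
Hypothesis ab : forall i j, i <> j -> commute (a i) (b j).
Hypothesis bb : forall i j, i <> j -> commute (b i) (b j).
Local Notation c i := [~ a i, b i]%g.
Hypothesis c_s : forall i, (c i q < s < c i (c i q))%R.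
Hypothesis a_t : forall i, (a i q < t < a i (c i q))%R.
Hypothesis b_u : forall i, (b i q < u < b i (c i q))%R.

Let ba i j : i <> j -> commute (b i) (a j).
Proof. by move=> ij; apply/commute_sym/ab => ji; exact: ij. Qed.

Let ca i j : i <> j -> commute (c i) (a j).
Proof.
by move=> ij; apply/commute_sym/commuteR; apply/commute_sym;
  [exact: aa|exact: ba].
Qed.

Let cb i j : i <> j -> commute (c i) (b j).
Proof.
by move=> ij; apply/commute_sym/commuteR; apply/commute_sym;
  [exact: ab|exact: bb].
Qed.

Let cc i j : i <> j -> commute (c i) (c j).
Proof. by move=> ij; apply: commuteR; [exact: ca|exact: cb]. Qed.

Let c_lt i k : (c i q < c k (c k q))%R.
Proof.
by have /andP[h _] := c_s i; have /andP[_] := c_s k; exact: lt_trans.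
Qed.

Let hull_a (i g k : nat) : k <> i -> k <> g ->
  hull (c k) q (((a g)^-1 * a i)%g q).
Proof.
move=> ki kg; have /andP[h1 h2] := a_t i; have /andP[h3 h4] := a_t g.
apply: (@hull_quotient _ _ _ (c i) (c g)) => //; first exact: ca.
- exact: ca.
- exact: lt_trans h1 h4.
- exact: lt_trans h3 h2.
Qed.

Let hull_b (i d k : nat) : k <> i -> k <> d ->
  hull (c k) q (((b d)^-1 * b i)%g q).
Proof.
move=> ki kd; have /andP[h1 h2] := b_u i; have /andP[h3 h4] := b_u d.
apply: (@hull_quotient _ _ _ (c i) (c d)) => //; first exact: cb.
- exact: cb.
- exact: lt_trans h1 h4.
- exact: lt_trans h3 h2.
Qed.

(** The shift of a i commutes with both a i and the second argument of the
    commutator, since g differs from i and from d; then so does the shift of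
    b i with a i. *)
Lemma comm_shift_invariant (g d i : nat) : g <> d -> g <> i -> d <> i ->
  [~ (a g)^-1 * a i, (b d)^-1 * b i] = c i.
Proof.
move=> gd gi di; rewrite commgMl.
- by rewrite commgMr //; apply: commuteVl; [exact: ba|exact: bb].
- by apply: commuteVl; exact: aa.
- by apply: commuteVl; apply: commuteM; [apply: commuteV|]; exact: ab.
Qed.

(** The product c i * c j is a single commutator of elements that commute with
    c k and keep q in its hull, once a and b are shifted by the spare indices
    g and d; these must differ because a g and b g do not commute. *)
Lemma comm_pair_lt (g d i j k : nat) : uniq [:: g; d; i; j; k] ->
  (c i (c j q) < c k (c k q))%R.
Proof.
have sy (m n : nat) : m <> n -> n <> m by move=> mn nm; exact: mn.
rewrite !cons_uniq !inE !negb_or => /and5P[].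
move=> /and4P[/eqP gd /eqP gi /eqP gj /eqP gk] /and3P[/eqP di /eqP dj /eqP dk].
move=> /andP[/eqP ij /eqP ik] /eqP jk _.
rewrite -(homeo_plusME (c i)) -(comm_shift_invariant gd gi di).
rewrite -(comm_shift_invariant gd gj dj) -commgMM.
- apply: comm_lt_hull.
  + by do !apply: commuteM; do ?apply: commuteV; apply: ca; exact: sy.
  + by do !apply: commuteM; do ?apply: commuteV; apply: cb; exact: sy.
  + apply: hullM; [|by apply: hull_a; exact: sy..].
    by do !apply: commuteM; do ?apply: commuteV; apply: ca; exact: sy.
  + apply: hullM; [|by apply: hull_b; exact: sy..].
    by do !apply: commuteM; do ?apply: commuteV; apply: cb; exact: sy.
- apply: commuteMl; [apply: commuteVl|]; apply: commuteM; try apply: commuteV;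
  by [exact: commute_refl|apply: aa => //; exact: sy].
- apply: commuteMl; [apply: commuteVl|]; apply: commuteM; try apply: commuteV;
  by apply: ab => //; exact: sy.
- apply: commuteMl; [apply: commuteVl|]; apply: commuteM; try apply: commuteV;
  by apply: ba => //; exact: sy.
- apply: commuteMl; [apply: commuteVl|]; apply: commuteM; try apply: commuteV;
  by [exact: commute_refl|apply: bb => //; exact: sy].
Qed.

(** Writing c_0, c_1, c_2 additively, the three inequalities c_i + c_j < 2 c_k
    have equal sums on both sides. *)
Lemma no_five_commuting_pairs : False.
Proof.
have l012 := @comm_pair_lt 3%N 4%N 0%N 1%N 2%N isT.
have l120 := @comm_pair_lt 3%N 4%N 1%N 2%N 0%N isT.
have l021 := @comm_pair_lt 3%N 4%N 0%N 2%N 1%N isT.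
have C (m n : nat) x : m <> n -> c m (c n x) = c n (c m x).
  by move=> mn; apply: homeo_commuteE; exact: cc.
have : (c 0%N (c 2%N (c 1%N (c 1%N q))) < c 0%N (c 2%N (c 0%N (c 2%N q))))%R.
  rewrite (C 2%N 1%N) // (C 2%N 1%N) // (C 2%N 0%N) //.
  apply: (@lt_trans _ _ (c 0%N (c 1%N (c 0%N (c 0%N q)))));
    first by rewrite !homeo_ltE.
  by rewrite (C 1%N 0%N) // (C 1%N 0%N) // !homeo_ltE.
by rewrite !homeo_ltE ltNge ltW.
Qed.

End CommutingPairs.
End Hull.

(** * Pigeonhole and the direct sum *)

Lemma pigeonhole_infinite (I : Type) (K : countType) (P : I -> K -> Prop) :
  ~ countable [set: I] -> (forall i, exists k, P i k) ->
  exists k, exists2 e : nat -> I, injective e & forall n, P (e n) k.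
Proof.
move=> I_unc /choice[f Pf].
have [k fk] : exists k, infinite_set (f @^-1` [set k]).
  apply: contrapT => /forallNP fin; apply: I_unc.
  have -> : [set: I] = \bigcup_k (f @^-1` [set k]).
    by apply/seteqP; split=> i // _; exists (f i).
  apply: bigcup_countable => // k _; apply: finite_set_countable.
  exact: contrapT (fin k).
have /card_leP[e] := iffLR (infiniteP _) fk.
pose e' n := set_val (e (to_setT n)).
exists k, e' => [m n emn|n].
  have /(congr1 val) // : to_setT m = to_setT n.
  by apply: (@inj _ _ _ e); rewrite ?in_setT //; exact: val_inj emn.
by have /= <- := set_valP (e (to_setT n)); exact: Pf.
Qed.

Section Single.
Variables (I : Type) (G : groupType) (i : I).

Definition single_fun (g : G) : direct_product I G :=
  fun j => if `[< j = i >] then g else 1.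

Fact single_finsupp g : finsupp_pred (single_fun g).
Proof.
apply/asboolP; apply: (@sub_finite_set _ _ [set i]); last exact: finite_set1.
by move=> j /=; rewrite /single_fun; case: asboolP.
Qed.

Definition single g : direct_sum I G := Sub (single_fun g) (single_finsupp g).

End Single.

Lemma direct_sum_eq (I : Type) (G : groupType) (x y : direct_sum I G) :
  (forall j, val x j = val y j) -> x = y.
Proof. by move=> xy; apply: val_inj; exact/funext. Qed.

Lemma singleM (I : Type) (G : groupType) (i : I) (g h : G) :
  single i (g * h) = single i g * single i h.
Proof.
apply: direct_sum_eq => j; rewrite direct_sumME /= /single_fun.
by case: asboolP => // _; rewrite mulg1.
Qed.

Lemma single_commute (I : Type) (G : groupType) (i j : I) (g h : G) :
  i <> j -> commute (single i g) (single j h).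
Proof.
move=> ij; apply: direct_sum_eq => k; rewrite !direct_sumME /= /single_fun.
case: asboolP => [->|_]; last by rewrite mul1g mulg1.
by case: asboolP => // _; rewrite mul1g mulg1.
Qed.

Lemma single_inj (I : Type) (G : groupType) (i : I) :
  injective (@single I G i).
Proof.
move=> g h /(congr1 (fun x => val x i)) /=.
by rewrite /single_fun; case: asboolP.
Qed.

(** * Rational markings *)

(** If f x > x, then a rational r between x and f x satisfies
    f r > f x > r; similarly if f x < x. *)
Lemma homeo_moves_rat (R : realType) (f : homeo_plus R) : f <> 1 ->
  exists r : rat, f (ratr r) <> ratr r.
Proof.
move=> f1; have [x fx] : exists x, f x <> x.
  by apply: contrapT => /forallNP fx; apply: f1; apply: homeo_plus_eq => x;
    exact: contrapT (fx x).
have [xf|fx'|/esym/fx//] := ltgtP x (f x).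
- have [r] := rat_in_itvoo xf; rewrite in_itv /= => /andP[xr rf].
  exists r => e.
  by move: (xr); rewrite -(homeo_ltE f) e => /(lt_trans rf); rewrite ltxx.
- have [r] := rat_in_itvoo fx'; rewrite in_itv /= => /andP[fr rx].
  exists r => e.
  by move: (rx); rewrite -(homeo_ltE f) e => /(lt_trans fr); rewrite ltxx.
Qed.

(** The rational q is moved to the right by the commutator, and s, t, u mark the
    images under c, a and b of the interval from q to c q.  The pair p is (x, y)
    or (y, x): exchanging them inverts the commutator, hence turns a motion to
    the left into one to the right. *)
Lemma noncommuting_markers (R : realType) (H : groupType)
    (F : H -> homeo_plus R) (x y : H) :
  ~ commute (F x) (F y) ->
  exists k : rat * rat * rat * rat, exists p : H * H,
    let: (q, s, t, u) := k in
    let a := F p.1 in let b := F p.2 in let c := [~ a, b] in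
    [/\ (c (ratr q) < ratr s < c (c (ratr q)))%R,
        (a (ratr q) < ratr t < a (c (ratr q)))%R &
        (b (ratr q) < ratr u < b (c (ratr q)))%R].
Proof.
move=> nC.
have [q] : exists q : rat, [~ F x, F y] (ratr q) <> ratr q.
  by apply: homeo_moves_rat => /eqP/commgP.
wlog qc : x y nC / (ratr q < [~ F x, F y]%g (ratr q))%R => [wl /eqP|_].
  rewrite neq_lt => /orP[cq|qc]; last first.
    by apply: (wl x y) => //; apply/eqP; rewrite gt_eqF.
  have qc : (ratr q < [~ F y, F x]%g (ratr q))%R.
    by rewrite -(homeo_ltE [~ F x, F y]) -(invgR (F x)) homeo_mulKV.
  apply: (wl y x) => //; first by move/commute_sym.
  by apply/eqP; rewrite gt_eqF.
set c := [~ F x, F y] in qc *.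
have mark (f : homeo_plus R) :
    exists r : rat, (f (ratr q) < ratr r < f (c (ratr q)))%R.
  have := qc; rewrite -(homeo_ltE f) => /rat_in_itvoo[r].
  by rewrite in_itv; exists r.
have [[s ?] [t ?] [u ?]] := And3 (mark c) (mark (F x)) (mark (F y)).
by exists (q, s, t, u), (x, y).
Qed.

Unset Implicit Arguments.

Theorem mainTheorem2 (R : realType) (G : groupType) (I : Type)
    (G_nonabelian : ~ (forall x y : G, x * y = y * x))
    (I_uncountable : ~ countable [set: I]) :
  ~ (exists phi : {multiplicative direct_sum I G -> homeo_plus R},
       injective phi).
Proof.
move=> [phi phi_inj]; apply: G_nonabelian => x y; apply: contrapT => xy.
pose F i g := phi (single i g).
have FC i j g h : i <> j -> commute (F i g) (F j h).
  by move=> ij; apply: gmulf_commute; exact: single_commute.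
have nC i : ~ commute (F i x) (F i y).
  by rewrite /commute -!gmulfM -!singleM => e;
    exact: xy (single_inj (phi_inj _ _ e)).
have [[[[q s] t] u] [e e_inj ek]] :=
  pigeonhole_infinite I_uncountable (fun i => noncommuting_markers (nC i)).
have [p pP] := choice ek.
have eC (m n : nat) g h : m <> n -> commute (F (e m) g) (F (e n) h).
  by move=> mn; apply: FC => /e_inj.
apply: (@no_five_commuting_pairs R (fun n => F (e n) (p n).1)
  (fun n => F (e n) (p n).2) (ratr q) (ratr s) (ratr t) (ratr u));
  try by move=> m n; exact: eC.
all: by move=> n; case: (pP n).
Qed.
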